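(* Let $n > 1$ be an integer and let $(X,d) = (\{x_0, x_1, \ldots, x_n\}, d)$ be an $(n+1)$-point metric space. The following conditions are equivalent: (1) $(X,d)$ has strict $2$-negative type. (2) $(X,d)$ can be isometrically embedded in the Euclidean space $\mathbb{R}^n$ of dimension $n$, but it cannot be isometrically embedded in any Euclidean space $\mathbb{R}^r$ of dimension $r < n$. (3) There exists an isometry $\phi : (X,d) \to \mathbb{R}^n$ such that the set $\{\phi(x_1) - \phi(x_0), \phi(x_2) - \phi(x_0), \ldots, \phi(x_n) - \phi(x_0)\}$ is linearly independent.
   Context: Let $p \ge 0$. A metric space $(X,d)$ has $p$-negative type if for all finite subsets $\{z_1, \ldots, z_m\} \subseteq X$ (with $z_1,\ldots,z_m$ distinct) and all real numbers $\eta_1, \ldots, \eta_m$ with $\eta_1 + \cdots + \eta_m = 0$ we have $\sum_{1 \le i,j \le m} d(z_i,z_j)^p \eta_i \eta_j \le 0$. It has strict $p$-negative type if it has $p$-negative type and this inequality is strict whenever $(\eta_1, \ldots, \eta_m) \ne (0, \ldots, 0)$. Here ''isometry'' means a distance-preserving map (not necessarily surjective), and $\mathbb{R}^n$ carries the Euclidean metric. *)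

(* Defs.v *)
From mathcomp Require Import all_boot all_order all_algebra.
From mathcomp Require Import all_classical all_reals all_analysis.

Set Implicit Arguments.
Unset Strict Implicit.
Unset Printing Implicit Defensive.

Import Order.TTheory GRing.Theory Num.Theory.
Local Open Scope ring_scope.

(* The sum over 1 <= i, j <= m of d(z_i, z_j)^p eta_i eta_j. The exponent is
   real; [powR] has 0 `^ 0 = 1, so the diagonal terms vanish only for p != 0. *)
Definition neg_type_sum (R : realType) (X : metricType R) (p : R) (m : nat)
    (z : 'I_m -> X) (eta : 'I_m -> R) : R :=
  \sum_(i < m) \sum_(j < m) (mdist (z i) (z j) `^ p) * eta i * eta j.

Definition negative_type (R : realType) (p : R) (X : metricType R) : Prop :=
  forall (m : nat) (z : 'I_m -> X) (eta : 'I_m -> R),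
    injective z -> \sum_(i < m) eta i = 0 -> neg_type_sum p z eta <= 0.

Definition strict_negative_type (R : realType) (p : R) (X : metricType R) :
    Prop :=
  negative_type p X /\
  forall (m : nat) (z : 'I_m -> X) (eta : 'I_m -> R),
    injective z -> \sum_(i < m) eta i = 0 -> (exists i, eta i != 0) ->
    neg_type_sum p z eta < 0.

(* The metric that the library puts on row vectors comes from the sup norm. *)
Definition euclidean_dist (R : realType) (r : nat) (u v : 'rV[R]_r) : R :=
  Num.sqrt (\sum_(k < r) (u 0 k - v 0 k) ^+ 2).

Definition euclidean_isometry (R : realType) (X : metricType R) (r : nat)
    (phi : X -> 'rV[R]_r) : Prop :=
  forall a b : X, euclidean_dist (phi a) (phi b) = mdist a b.

Definition isometrically_embeds (R : realType) (X : metricType R) (r : nat) :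
    Prop :=
  exists phi : X -> 'rV[R]_r, euclidean_isometry phi.

(* Main.v *)
Require Import Defs.
From mathcomp Require Import all_boot all_order all_algebra.
From mathcomp Require Import all_classical all_reals all_analysis.
From mathcomp Require Import ring lra.

Set Implicit Arguments.
Unset Strict Implicit.
Unset Printing Implicit Defensive.

Import Order.TTheory GRing.Theory Num.Theory.
Local Open Scope ring_scope.

(** Everything is read off one matrix, the Gram matrix G of (X, d) at the base
point x_0, with entries
  (d(x_0, x_i)^2 + d(x_0, x_j)^2 - d(x_i, x_j)^2) / 2  for 1 <= i, j <= n.
By the law of cosines, an isometry phi into R^r is, up to translation, the same
thing as a factorization G = V V^T with V of size n x r, whose rows are the
edge vectors phi(x_i) - phi(x_0) ([edge_mx_gram], [embeds_of_gram]). On the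
other hand, in the quadratic form of 2-negative type the contributions of the
squared distances to x_0 cancel because sum eta = 0, which leaves -2 times the
quadratic form of inner products at x_0 ([neg_type_sum_cosprod]): that of G
when the points are the x_i ([neg_type_sum_gram]), and
  -2 |sum_i eta_i (phi(z_i) - phi(x_0))|^2
in the presence of an isometry phi ([neg_type_sum_isometry]).

From strict negative type to minimal dimension n: strictness says that G is
positive definite ([strict_negative_type_gram]), so the Cholesky factorization
G = L L^T ([posdefmx_cholesky]) embeds X in R^n. An embedding in R^r with r < n
would make G = V V^T of rank less than n.

From minimal dimension n to independent edge vectors: if the edge matrix V of
an embedding in R^n had rank r < n, write V = C B with C of size n x r and B of
full row rank r. Then B B^T is positive definite, hence equal to some L L^T, so
G = (C L)(C L)^T embeds X in R^r, against minimality.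

From independent edge vectors to strict negative type: the form is minus twice
a squared norm, hence nonpositive, and it vanishes only if the eta_i give a
linear relation between the edge vectors ([edge_mx_strict_negative_type]). *)

(** * Positive definite matrices and Cholesky factorization *)

Definition posdefmx (R : realType) (n : nat) (A : 'M[R]_n) : Prop :=
  A^T = A /\ forall c : 'rV[R]_n, c != 0 -> 0 < (c *m A *m c^T) 0 0.

Lemma mul_trmx_coef (R : realType) (r : nat) (u v : 'rV[R]_r) :
  (u *m v^T) 0 0 = \sum_(k < r) u 0 k * v 0 k.
Proof. by rewrite mxE; apply: eq_bigr => k _; rewrite mxE. Qed.

Lemma mul_trmx_row_coef (R : realType) (n r : nat) (A : 'M[R]_(n, r)) i j :
  (row i A *m (row j A)^T) 0 0 = (A *m A^T) i j.
Proof. by rewrite !mxE; apply: eq_bigr => k _; rewrite !mxE. Qed.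

Lemma sqnorm_ge0 (R : realType) (r : nat) (u : 'rV[R]_r) :
  0 <= (u *m u^T) 0 0.
Proof.
by rewrite mul_trmx_coef; apply: sumr_ge0 => k _; rewrite -expr2 sqr_ge0.
Qed.

Lemma sqnorm_eq0 (R : realType) (r : nat) (u : 'rV[R]_r) :
  ((u *m u^T) 0 0 == 0) = (u == 0).
Proof.
apply/eqP/eqP => [|->]; last by rewrite mul0mx mxE.
rewrite mul_trmx_coef => /psumr_eq0P u0; apply/rowP => k.
have /eqP := u0 (fun i _ => sqr_ge0 (u 0 i)) k isT.
by rewrite mxE mulf_eq0 orbb => /eqP.
Qed.

Lemma posdefmx_gram (R : realType) (n r : nat) (B : 'M[R]_(n, r)) :
  row_free B -> posdefmx (B *m B^T).
Proof.
move=> Bfree; split=> [|c c0]; first by rewrite trmx_mul trmxK.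
rewrite mulmxA -mulmxA -trmx_mul lt_neqAle sqnorm_ge0 andbT eq_sym.
by rewrite sqnorm_eq0 mulmx_free_eq0.
Qed.

(** The induction splits off the first row and column: if A has blocks a, b,
b^T, S, the Schur complement S - b^T b / a is again positive definite, since
its value at c is the value of A at (t, c) for the minimizing
t = - (b c^T) / a. *)
Lemma posdefmx_cholesky (R : realType) (n : nat) (A : 'M[R]_n) :
  posdefmx A -> exists L : 'M[R]_n, L *m L^T = A.
Proof.
elim: n A => [|n IHn] A [Asym Apos].
  by exists 0; rewrite mul0mx [A]flatmx0.
pose A' : 'M[R]_(1 + n) := A.
pose a : R := ulsubmx A' 0 0; pose b := ursubmx A'; pose S := drsubmx A'.
have defA : A' = block_mx a%:M b b^T S.
  rewrite -[LHS]submxK -(mx11_scalar (ulsubmx A')); congr (block_mx _ _ _ _).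
  by rewrite trmx_ursub [A'^T]Asym.
have Ssym : S^T = S by rewrite trmx_drsub [A'^T]Asym.
(* The quadratic form of A at (t, c), as a polynomial in t. *)
have quadE t (c : 'rV_n) : (row_mx t%:M c *m A' *m (row_mx t%:M c)^T) 0 0 =
    a * t ^+ 2 + 2 * t * (b *m c^T) 0 0 + (c *m S *m c^T) 0 0.
  rewrite defA mul_row_block tr_row_mx mul_row_col !mulmxDl tr_scalar_mx.
  rewrite -!scalar_mxM !mul_scalar_mx !mul_mx_scalar.
  have -> : c *m b^T = (b *m c^T)^T by rewrite trmx_mul trmxK.
  rewrite -scalemxAl.
  by rewrite !mxE /= mulr1n; ring.
have a_gt0 : 0 < a.
  have e0 : row_mx 1%:M 0 != 0 :> 'rV[R]_(1 + n).
    apply/eqP => /(congr1 (fun M : 'rV_(1 + n) => M 0 (lshift n 0))).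
    by rewrite row_mxEl !mxE /= => /eqP; rewrite oner_eq0.
  by have := Apos _ e0; rewrite -[A]/A' quadE trmx0 !mulmx0 !mxE; lra.
have [|L' defL'] := IHn (S - a^-1 *: (b^T *m b)).
  split=> [|c c0].
    by rewrite linearB /= linearZ /= trmx_mul trmxK Ssym.
  set s := (b *m c^T) 0 0.
  have sc0 : row_mx (- s / a)%:M c != 0 :> 'rV[R]_(1 + n).
    apply: contraNneq c0 => /(congr1 (@rsubmx _ _ 1 n)).
    by rewrite row_mxKr linear0 => ->.
  have := Apos _ sc0; rewrite -[A]/A' quadE -/s.
  have sE : c *m (b^T *m b) *m c^T = (s * s)%:M.
    have -> : c *m (b^T *m b) *m c^T = (c *m b^T) *m (b *m c^T).
      by rewrite !mulmxA.
    have -> : c *m b^T = (b *m c^T)^T by rewrite trmx_mul trmxK.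
    by rewrite [b *m c^T]mx11_scalar -/s tr_scalar_mx -scalar_mxM.
  rewrite mulmxBr mulmxBl -scalemxAr -scalemxAl sE.
  move: (c *m S *m c^T) => Q; rewrite !mxE /= mulr1n.
  suff -> : Q 0 0 - a^-1 * (s * s) =
      a * (- s / a) ^+ 2 + 2 * (- s / a) * s + Q 0 0 by [].
  by field; rewrite gt_eqF.
pose h := Num.sqrt a.
have hh : h * h = a by rewrite -expr2 sqr_sqrtr // ltW.
have h0 : h != 0 by rewrite gt_eqF // sqrtr_gt0.
pose L : 'M[R]_(1 + n) := block_mx h%:M 0 (h^-1 *: b^T) L'.
suff defL : L *m L^T = A' by exists L.
rewrite defA tr_block_mx mulmx_block !trmx0 !mulmx0 !mul0mx !addr0.
rewrite defL' tr_scalar_mx -scalar_mxM hh linearZ /= trmxK.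
rewrite mul_scalar_mx mul_mx_scalar !scalerA divff // !scale1r.
rewrite -scalemxAl -scalemxAr scalerA -invfM hh addrC subrK.
by [].
Qed.

(** * The law of cosines in a metric space *)

(** The value that the law of cosines gives to the inner product of the
vectors from o to a and from o to b. *)
Definition cosprod (R : realType) (X : metricType R) (o a b : X) : R :=
  (mdist o a ^+ 2 + mdist o b ^+ 2 - mdist a b ^+ 2) / 2.

Lemma sqr_euclidean_dist (R : realType) (r : nat) (u v : 'rV[R]_r) :
  euclidean_dist u v ^+ 2 = ((u - v) *m (u - v)^T) 0 0.
Proof.
rewrite mul_trmx_coef sqr_sqrtr; last by apply: sumr_ge0 => k _; apply: sqr_ge0.
by apply: eq_bigr => k _; rewrite !mxE expr2.
Qed.

Lemma sqnormB (R : realType) (r : nat) (u v : 'rV[R]_r) :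
  ((u - v) *m (u - v)^T) 0 0 =
  (u *m u^T) 0 0 + (v *m v^T) 0 0 - 2 * (u *m v^T) 0 0.
Proof.
rewrite !mul_trmx_coef mulr_sumr -big_split -sumrB /=.
by apply: eq_bigr => k _; rewrite !mxE; ring.
Qed.

Lemma isometry_cosprod (R : realType) (X : metricType R) (r : nat)
    (phi : X -> 'rV[R]_r) (o a b : X) :
  euclidean_isometry phi ->
  ((phi a - phi o) *m (phi b - phi o)^T) 0 0 = cosprod o a b.
Proof.
move=> iso; rewrite /cosprod ![mdist o _]metric_sym -!iso !sqr_euclidean_dist.
have -> : phi a - phi b = (phi a - phi o) - (phi b - phi o).
  by rewrite opprB addrA subrK.
by rewrite [in RHS](sqnormB (phi a - phi o)); field.
Qed.

Lemma cosprod_isometry (R : realType) (X : metricType R) (r : nat)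
    (phi : X -> 'rV[R]_r) (o : X) :
  (forall a b, (phi a *m (phi b)^T) 0 0 = cosprod o a b) ->
  euclidean_isometry phi.
Proof.
move=> phiE a b; apply/eqP; rewrite -(@eqrXn2 _ 2) ?sqrtr_ge0 ?mdist_ge0 //.
apply/eqP; rewrite sqr_euclidean_dist sqnormB !phiE /cosprod !mdistxx.
by field.
Qed.

(** Substituting d(z_i, z_j)^2 = d(o, z_i)^2 + d(o, z_j)^2 - 2 <z_i, z_j>_o,
the first two terms depend on one index only and vanish because the eta_i
sum to 0. *)
Lemma neg_type_sum_cosprod (R : realType) (X : metricType R) (o : X) (m : nat)
    (z : 'I_m -> X) (eta : 'I_m -> R) :
  \sum_(i < m) eta i = 0 ->
  neg_type_sum 2 z eta =
  - 2 * \sum_(i < m) \sum_(j < m) cosprod o (z i) (z j) * eta i * eta j.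
Proof.
move=> eta0; pose f i := mdist o (z i) ^+ 2.
transitivity (\sum_(i < m) (f i * eta i * (\sum_(j < m) eta j) +
    eta i * \sum_(j < m) f j * eta j
    - 2 * \sum_(j < m) cosprod o (z i) (z j) * eta i * eta j)).
  apply: eq_bigr => i _; rewrite !mulr_sumr -big_split -sumrB /=.
  apply: eq_bigr => j _; rewrite powR_mulrn ?mdist_ge0 // /cosprod /f.
  by field.
by rewrite sumrB big_split /= -!mulr_suml eta0 mulr0 mul0r -mulr_sumr; ring.
Qed.

Lemma neg_type_sum_isometry (R : realType) (X : metricType R) (r : nat)
    (phi : X -> 'rV[R]_r) (o : X) (m : nat) (z : 'I_m -> X)
    (eta : 'I_m -> R) (v := \sum_(i < m) eta i *: (phi (z i) - phi o)) :
  euclidean_isometry phi -> \sum_(i < m) eta i = 0 ->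
  neg_type_sum 2 z eta = - 2 * (v *m v^T) 0 0.
Proof.
move=> iso eta0; rewrite (neg_type_sum_cosprod o z eta0); congr (_ * _).
rewrite {1}/v mulmx_suml summxE; apply: eq_bigr => i _.
rewrite /v linear_sum /= mulmx_sumr summxE; apply: eq_bigr => j _.
rewrite linearZ /= -scalemxAr -scalemxAl !mxE -(isometry_cosprod o _ _ iso).
by rewrite mxE; ring.
Qed.

(** * The Gram matrix of a finite metric space *)

Definition gram (R : realType) (X : metricType R) (n : nat)
    (x : 'I_n.+1 -> X) : 'M[R]_n :=
  \matrix_(i, j) cosprod (x ord0) (x (lift ord0 i)) (x (lift ord0 j)).

Definition edge_mx (R : realType) (X : metricType R) (n r : nat)
    (phi : X -> 'rV[R]_r) (x : 'I_n.+1 -> X) : 'M[R]_(n, r) :=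
  \matrix_i (phi (x (lift ord0 i)) - phi (x ord0)).

Lemma edge_mx_gram (R : realType) (X : metricType R) (n r : nat)
    (phi : X -> 'rV[R]_r) (x : 'I_n.+1 -> X) :
  euclidean_isometry phi -> edge_mx phi x *m (edge_mx phi x)^T = gram x.
Proof.
move=> iso; apply/matrixP => i j; rewrite -mul_trmx_row_coef !rowK.
by rewrite isometry_cosprod // !mxE.
Qed.

(** The base point goes to the origin and the other points to the rows of W;
the inner products then determine the distances by the law of cosines. *)
Lemma embeds_of_gram (R : realType) (X : metricType R) (n r : nat)
    (x : 'I_n.+1 -> X) (W : 'M[R]_(n, r)) :
  bijective x -> W *m W^T = gram x -> isometrically_embeds X r.
Proof.
case=> y xK yK defW.
pose u k : 'rV[R]_r := if unlift ord0 k is Some i then row i W else 0.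
exists (u \o y); apply: (@cosprod_isometry _ _ _ _ (x ord0)) => a b /=.
rewrite -[a in RHS]yK -[b in RHS]yK /u.
case: unliftP => [i|] ->; case: unliftP => [j|] ->.
- by rewrite mul_trmx_row_coef defW mxE.
- by rewrite trmx0 mulmx0 mxE /cosprod mdistxx (metric_sym (x ord0)); ring.
- by rewrite mul0mx mxE /cosprod mdistxx; ring.
- by rewrite mul0mx mxE /cosprod mdistxx; ring.
Qed.

Lemma neg_type_sum_gram (R : realType) (X : metricType R) (n : nat)
    (x : 'I_n.+1 -> X) (eta : 'I_n.+1 -> R)
    (c : 'rV[R]_n := \row_i eta (lift ord0 i)) :
  \sum_i eta i = 0 ->
  neg_type_sum 2 x eta = - 2 * (c *m gram x *m c^T) 0 0.
Proof.
move=> eta0; rewrite (neg_type_sum_cosprod (x ord0) x eta0); congr (_ * _).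
rewrite -mulmxA mxE big_ord_recl big1 ?add0r => [|j _]; last first.
  by rewrite /cosprod mdistxx; ring.
apply: eq_bigr => i _; rewrite big_ord_recl /cosprod mdistxx.
rewrite (metric_sym (x ord0) (x (lift ord0 i))) expr0n addr0 subrr !mul0r add0r.
rewrite !mxE mulr_sumr; apply: eq_bigr => j _.
by rewrite !mxE /cosprod (metric_sym (x ord0) (x (lift ord0 i))); ring.
Qed.

(** A vector c of length n extends uniquely to weights of total 0 on the n + 1
points, the base point receiving minus the sum of c; these weights turn
strictness into positivity of the Gram form at c. *)
Lemma strict_negative_type_gram (R : realType) (X : metricType R) (n : nat)
    (x : 'I_n.+1 -> X) :
  injective x -> strict_negative_type 2 X -> posdefmx (gram x).
Proof.
move=> xinj [_ Xneg]; split=> [|c c0].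
  apply/matrixP => i j; rewrite !mxE /cosprod.
  by rewrite (metric_sym (x (lift ord0 j))) [_ + mdist _ _ ^+ 2]addrC.
pose eta k := if unlift ord0 k is Some i then c 0 i else - \sum_j c 0 j.
have etaS i : eta (lift ord0 i) = c 0 i by rewrite /eta liftK.
have eta0 : \sum_i eta i = 0.
  rewrite big_ord_recl {1}/eta unlift_none.
  by rewrite (eq_bigr _ (fun i _ => etaS i)) addNr.
have [i ci] : exists i, c 0 i != 0 by apply/rV0Pn.
have etaN0 : exists k, eta k != 0 by exists (lift ord0 i); rewrite etaS.
have := Xneg _ x eta xinj eta0 etaN0; rewrite neg_type_sum_gram //.
have -> : \row_i eta (lift ord0 i) = c by apply/rowP=> k; rewrite mxE etaS.
by rewrite mulNr oppr_lt0 pmulr_rgt0.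
Qed.

(** * Independent edge vectors and strict negative type *)

Lemma free_row_free (R : realType) (n r : nat) (f : 'I_n -> 'rV[R]_r) :
  free [seq f i | i : 'I_n] = row_free (\matrix_i f i).
Proof.
set V := \matrix_i f i.
have rowV i : row i V = (mktuple f)`_i by rewrite rowK -tnth_nth tnth_mktuple.
apply/(@freeP _ _ _ (mktuple f))/idP => [freeV | freeV k].
  rewrite -kermx_eq0; apply/rowV0P => c /sub_kermxP.
  rewrite mulmx_sum_row => cV0; apply/rowP => i; rewrite mxE.
  apply: (freeV (c 0)); rewrite -[RHS]cV0.
  by apply: eq_bigr => j _; rewrite rowV.
move=> kV0 i; have : (\row_i k i) *m V == 0.
  rewrite mulmx_sum_row; apply/eqP; rewrite -[RHS]kV0.
  by apply: eq_bigr => j _; rewrite mxE rowV.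
by rewrite mulmx_free_eq0 // => /eqP/rowP/(_ i); rewrite !mxE.
Qed.

(** If the form vanishes at eta, then sum_i eta_i (phi(z_i) - phi(x_0)) = 0.
Grouping the indices i by the point z_i gives a linear relation between the
edge vectors, so the weight of every z_i other than x_0 is 0, as the z_i are
distinct; the total being 0, the weight of x_0 vanishes as well. *)
Lemma edge_mx_strict_negative_type (R : realType) (X : metricType R)
    (n r : nat) (phi : X -> 'rV[R]_r) (x : 'I_n.+1 -> X) :
  bijective x -> euclidean_isometry phi -> row_free (edge_mx phi x) ->
  strict_negative_type 2 X.
Proof.
move=> [y xK yK] iso Vfree.
pose o := x ord0.
split=> m z eta zinj eta0.
  by rewrite (neg_type_sum_isometry o z iso eta0) mulNr oppr_le0 mulr_ge0
             ?sqnorm_ge0.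
case=> i0 eta_i0; rewrite (neg_type_sum_isometry o z iso eta0).
rewrite mulNr oppr_lt0 pmulr_rgt0 // lt_neqAle sqnorm_ge0 andbT eq_sym.
rewrite sqnorm_eq0; apply: contra_neqN eta_i0 => /eqP v0.
(* The fibre over each k has at most one element, and may be empty. *)
pose c : 'rV[R]_n := \row_k \sum_(i | y (z i) == lift ord0 k) eta i.
have : c *m edge_mx phi x == 0.
  apply/eqP; rewrite mulmx_sum_row -[RHS]v0.
  rewrite [RHS](partition_big (y \o z) predT) //= big_ord_recl.
  rewrite [X in _ = X + _]big1 ?add0r => [|i /eqP yzi]; last first.
    by rewrite /o -yzi yK subrr scaler0.
  apply: eq_bigr => k _; rewrite rowK mxE scaler_suml.
  by apply: eq_bigr => i /eqP <-; rewrite yK.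
rewrite mulmx_free_eq0 // => /eqP/rowP c0.
have only i j : y (z i) = y (z j) -> i = j by move/(can_inj yK)/zinj.
have eta_lift i k : y (z i) = lift ord0 k -> eta i = 0.
  move=> yzi; have := c0 k; rewrite !mxE (big_pred1 i) // => j.
  by rewrite -yzi; apply/eqP/eqP => [/only|->].
have [k /eta_lift // | yzi0] := unliftP ord0 (y (z i0)).
rewrite -eta0 (bigD1 i0) //= big1 ?addr0 // => i ii0.
have [k /eta_lift // | yzi] := unliftP ord0 (y (z i)).
by rewrite (only i i0) ?eqxx ?yzi ?yzi0 // in ii0.
Qed.

Theorem theorem3p3 (R : realType) (n : nat) (hn : (1 < n)%N)
    (X : metricType R) (x : 'I_n.+1 -> X) (hx : bijective x) :
  [<-> strict_negative_type 2 X;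
       isometrically_embeds X n /\
         (forall r : nat, (r < n)%N -> ~ isometrically_embeds X r);
       exists phi : X -> 'rV[R]_n, euclidean_isometry phi /\
         free [seq phi (x (lift ord0 i)) - phi (x ord0) | i : 'I_n]].
Proof.
tfae.
- move=> /(strict_negative_type_gram (bij_inj hx)) Gpos; split.
    by have [L] := posdefmx_cholesky Gpos; apply: embeds_of_gram.
  move=> r ltrn [phi iso].
  have : kermx (edge_mx phi x) != 0.
    rewrite kermx_eq0 /row_free neq_ltn.
    by rewrite (leq_ltn_trans (rank_leq_col _) ltrn).
  case/rowV0Pn => c /sub_kermxP cV0 /(Gpos.2).
  by rewrite -(edge_mx_gram x iso) mulmxA cV0 !mul0mx mxE ltxx.
- move=> [[phi iso] min_n]; exists phi; split => //.
  rewrite (free_row_free (fun i => _)) -/(edge_mx phi x).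
  set V := edge_mx phi x.
  apply: contraT => Vdep; case: (min_n (\rank V)).
    by rewrite ltn_neqAle rank_leq_row andbT.
  have [L defL] := posdefmx_cholesky (posdefmx_gram (row_base_free V)).
  apply: (@embeds_of_gram _ _ _ _ x (col_base V *m L) hx).
  rewrite -(edge_mx_gram x iso) -/V -[in RHS](mulmx_base V).
  rewrite 2!(trmx_mul (col_base V)).
  by rewrite !mulmxA -(mulmxA _ L) defL !mulmxA.
- move=> [phi [iso]]; rewrite (free_row_free (fun i => _)) -/(edge_mx phi x).
  exact: edge_mx_strict_negative_type.
Qed.
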